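(* For positive integers $n,k$, let $\Pi(n;k)$ be the set of lattice convex chains joining $(0,0)$ to $(n,n)$ with exactly $k$ edges. Then, as $n\to+\infty$, $$|\Pi(n;k)|=\frac{1}{k!}\binom{n-1}{k-1}^2(1+o(1)),$$ this formula being valid uniformly in $k$ for $k=o\!\left(n^{1/2}/(\log n)^{1/4}\right)$.
   Context: A lattice convex chain joining $(0,0)$ to $(n,n)$ with $k$ edges is a planar polygonal chain starting at $(0,0)$, ending at $(n,n)$, with vertices in $\mathbb{Z}^2$, consisting of exactly $k$ edges with strictly increasing slopes in $[0,+\infty]$ (each edge makes an angle in $[0,\pi/2]$ with the horizontal axis; horizontal and vertical edges are allowed). *)

(* Defs.v *)
From HB Require Import structures.
From mathcomp Require Import all_boot all_order all_algebra finmap.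
From mathcomp Require Import all_classical all_reals all_analysis.

Set Implicit Arguments.
Unset Strict Implicit.
Unset Printing Implicit Defensive.

Import Order.TTheory GRing.Theory Num.Theory.
Import numFieldNormedType.Exports.

Local Open Scope classical_set_scope.
Local Open Scope ring_scope.

Definition edges (v : seq (int * int)) : seq (int * int) :=
  if v is u :: w then pairmap (fun a b => b - a) u w else [::].

(* A nondegenerate edge at an angle in [0, pi/2] with the horizontal axis. *)
Definition quarter_plane_edge (d : int * int) : bool :=
  [&& d != 0, 0 <= d.1 & 0 <= d.2].

(* For edges as above, [+oo] is taken exactly on the vertical ones. *)
Definition slope (d : int * int) : \bar rat :=
  if d.1 == 0 then +oo%E else (d.2%:~R / d.1%:~R)%:E.

(* A chain is encoded by the list of its k + 1 vertices; since the slopes are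
   strictly increasing, this list is determined by the planar curve. *)
Definition lattice_convex_chain (n k : nat) (v : seq (int * int)) : Prop :=
  [/\ size v = k.+1,
      head (0, 0) v = (0, 0),
      last (0, 0) v = (n%:Z, n%:Z),
      all quarter_plane_edge (edges v) &
      sorted <%O (map slope (edges v))].

Definition chains (n k : nat) : set (seq (int * int)) :=
  [set v | lattice_convex_chain n k v].

Lemma finite_chains (n k : nat) : finite_set (chains n k).
Proof.
pose f (t : k.+1.-tuple ('I_n.+1 * 'I_n.+1)) : seq (int * int) :=
  [seq ((p.1 : nat)%:Z, (p.2 : nat)%:Z) | p : 'I_n.+1 * 'I_n.+1 <- t].
apply: (@sub_finite_set _ _ (f @` setT)); last exact: finite_image.
pose box (l p : int * int) : bool :=
  [&& 0 <= p.1, 0 <= p.2, p.1 <= l.1 & p.2 <= l.2].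
have boxP u w : 0 <= u.1 -> 0 <= u.2 ->
    all quarter_plane_edge (edges (u :: w)) -> all (box (last u w)) (u :: w).
  elim: w u => [|x w IH] u u1 u2 /=; first by rewrite /box u1 u2 !lexx.
  case/andP => /and3P[_ /= d1 d2] h.
  have x1 : u.1 <= x.1 by rewrite -subr_ge0.
  have x2 : u.2 <= x.2 by rewrite -subr_ge0.
  have := IH x (le_trans u1 x1) (le_trans u2 x2) h.
  move=> /= /andP[bx ->]; rewrite bx !andbT; case/and4P: bx => _ _ l1 l2.
  by rewrite /box u1 u2 (le_trans x1 l1) (le_trans x2 l2).
move=> [[]//|u w] [] sz /= hu hl he _.
have := boxP u w; rewrite hu /= => /(_ (lexx _) (lexx _)).
have -> : last (0, 0) w = (n%:Z, n%:Z) by rewrite -hl hu.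
rewrite -hu => /(_ he) hb.
have {}hb : all (box (n%:Z, n%:Z)) (u :: w) by [].
pose g (p : int * int) : 'I_n.+1 * 'I_n.+1 := (inord `|p.1|%N, inord `|p.2|%N).
have sz' : size (map g (u :: w)) == k.+1 by rewrite size_map; apply/eqP.
exists (Tuple sz') => //.
rewrite /f /= -map_comp -[RHS]/(u :: w) -[LHS]/(map _ (u :: w)).
rewrite -[RHS]map_id; apply/eq_in_map => -[a b] pw.
have /and4P[/= a0 b0 an bn] := allP hb _ pw.
case: a b a0 b0 an bn {pw} => [a|//] [b|//] _ _; rewrite !lez_nat => an bn.
by rewrite /g /= !inordK.
Qed.

Definition num_chains (n k : nat) : nat := #|` fset_set (chains n k)|.

(* Main.v *)
(** Ordering the edges turns a chain into k! pairs of sequences of k nonnegative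
    integers of sum n whose k edge vectors are nonzero and pairwise nonparallel.
    Compared with all pairs of compositions of n into k positive parts, of which
    there are S^2 with S = C(n-1, k-1), the errors are as follows.
    - A zero coordinate occurs at most once on each axis, so there are at most
      (S + k C)^2 pairs, with C = C(n-1, k-2) of order (k/n) S.
    - If the i-th and j-th edges of (a, b) are parallel, then (a_i, a_j) and
      (b_i, b_j) are multiples of one vector (p, q).  For k >= 3 the number of
      compositions with two prescribed parts decreases with the sum of these
      parts; comparing its sum over the multiples of p + q with its sum over all
      integers shows that at most C / (p + q) compositions have (a_i, a_j)
      proportional to (p, q).  The squares sum to at most C^2 (1 + ln n) over
      p, q <= n.  For k = 2 parallel edges force a = b.
    Relative to S^2 the errors are of order k^2 / n and k^4 ln n / n^2. *)

Require Import Defs.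
From mathcomp Require Import all_boot all_order all_algebra finmap zify ring lra.
From mathcomp Require Import all_classical all_reals all_analysis.

Set Implicit Arguments.
Unset Strict Implicit.
Unset Printing Implicit Defensive.

Import Order.TTheory GRing.Theory Num.Theory.
Import numFieldNormedType.Exports.
Import fintype boot.finset.

Local Open Scope ring_scope.

(** * Counting compositions by generating functions *)

(** The number of compositions of [m] into [k] positive parts. The case split is needed because
    ['C(m - 1, k - 1)] with truncated subtraction would give 1 for [k = 0] and for [k = 1],
    [m = 0]. *)
Definition ncomp (k m : nat) : nat :=
  if k is k'.+1 then if m is m'.+1 then 'C(m', k') else 0 else (m == 0).

(** Removing one positive part leaves a composition of some [i < m]. Formally this is the
    hockey-stick identity, by Pascal's rule. *)
Lemma ncompS k m : ncomp k.+1 m = (\sum_(i < m) ncomp k i)%N.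
Proof.
elim: m => [|m IH]; first by rewrite big_ord0.
rewrite big_ord_recr -IH /=; case: k {IH} => [|k]; first by case: m => [|m] /=; rewrite !bin0.
by case: m => [|m] //=; rewrite binS.
Qed.

Lemma leq_ncomp k m m' : (m <= m')%N -> (ncomp k.+1 m <= ncomp k.+1 m')%N.
Proof. by case: m m' => [|m] [|m'] //=; rewrite ltnS; apply: leq_bin2l. Qed.

(** Expanding the product gives one monomial per admissible choice function, with exponent the sum
    of its values. *)
Lemma card_sum_coef (I : finType) (n m : nat) (A : I -> pred nat) :
  #|[set f : {ffun I -> 'I_n.+1} |
      ((\sum_i f i)%N == m) && [forall i, A i (f i)]]|
  = (\prod_i \sum_(u < n.+1 | A i u) ('X^u : {poly nat}))`_m.
Proof.
rewrite (bigA_distr_big_dep (fun i (u : 'I_n.+1) => A i u) (fun i (u : 'I_n.+1) => 'X^u)) coef_sum.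
rewrite -sum1_card [LHS]big_mkcond [RHS]big_mkcond /=; apply: eq_bigr => f _.
rewrite inE (_ : [forall i, _] = (f \in family (fun i (u : 'I_n.+1) => A i u))); last first.
  by apply/forallP/familyP.
case: (_ \in _); rewrite ?andbF ?andbT //.
by rewrite -expr_sum coefXn eq_sym; case: eqP.
Qed.

(** The series X/(1-X) truncated at degree [n]; its powers keep the right coefficients up to degree
    [n]. *)
Definition posX n : {poly nat} := \sum_(u < n.+1 | (0 < u)%N) 'X^u.

Lemma coef_posX_exp n k m : (m <= n)%N -> (posX n ^+ k)`_m = ncomp k m.
Proof.
elim: k m => [|k IH] m mn; first by rewrite expr0 coef1 /=; case: eqP.
rewrite exprS ncompS /posX mulr_suml coef_sum big_mkcond /=.
rewrite -(big_mkord xpredT (fun u => if (0 < u)%N then ('X^u * posX n ^+ k)`_m else 0%N)).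
rewrite big_nat_recl //= add0r -(big_mkord xpredT (ncomp k)).
rewrite (big_cat_nat (n := m)) //= [X in (_ + X)%R]big1_seq ?addr0; last first.
  by move=> i; rewrite mem_index_iota => /andP[_ /andP[mi _]]; rewrite coefXnM ltnS mi.
(* After reversal the term [i] on the right is [ncomp k (m - i.+1)], the contribution of a first
   part equal to [i.+1]. *)
rewrite [RHS]big_nat_rev /= add0n; apply: eq_big_nat => i /andP[_ im].
by rewrite coefXnM ltnNge im /= IH // (leq_trans (leq_subr _ _)).
Qed.

Section Compositions.
Variables (n k : nat).
Implicit Types (a b : {ffun 'I_k -> 'I_n.+1}) (i j : 'I_k).

Definition positive_compositions : {set {ffun 'I_k -> 'I_n.+1}} :=
  [set a : {ffun 'I_k -> 'I_n.+1} | ((\sum_i a i)%N == n) && [forall i, 0 < a i]%N].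

Lemma card_positive_compositions : #|positive_compositions| = ncomp k n.
Proof.
rewrite (@card_sum_coef _ n n (fun _ u => (0 < u)%N)).
by rewrite prodr_const cardT size_enum_ord -/(posX n) coef_posX_exp.
Qed.

Lemma sum_eqX s : (s <= n)%N -> \sum_(u < n.+1 | nat_of_ord u == s) ('X^u : {poly nat}) = 'X^s.
Proof.
rewrite -ltnS => sn; rewrite (big_pred1 (Ordinal sn)) //.
Qed.

Lemma card_one_zero_compositions i :
  #|[set a : {ffun 'I_k -> 'I_n.+1} | ((\sum_j a j)%N == n) &&
      [forall j, if j == i then a j == 0 :> nat else (0 < a j)%N]]| = ncomp k.-1 n.
Proof.
rewrite (@card_sum_coef _ n n (fun j u => if j == i then u == 0 else (0 < u)%N)).
rewrite (bigD1 i) //= eqxx sum_eqX // expr0 mul1r.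
rewrite (eq_bigr (fun=> posX n)) => [|j /negPf ->] //.
by rewrite prodr_const cardC1 card_ord coef_posX_exp.
Qed.

(** The two prescribed parts contribute the factor X^(s+t), the other [k - 2] parts one factor
    [posX n] each. Only an upper bound holds: for [s = 0] or [t = 0] the left-hand set is empty. *)
Lemma card_compositions_fix2 i j s t : i != j ->
  (#|[set a in positive_compositions | (a i == s :> nat) && (a j == t :> nat)]|
   <= (s + t <= n)%N * ncomp (k - 2) (n - (s + t)))%N.
Proof.
move=> ij; have [stn|stn] := leqP (s + t) n; last first.
  rewrite mul0n leqn0 cards_eq0 -subset0; apply/subsetP => a.
  rewrite !inE => /andP[/andP[/eqP sa _] /andP[/eqP ai /eqP aj]].
  move: stn; rewrite -sa (bigD1 i) //= (bigD1 j) 1?eq_sym //= ai aj addnA.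
  by rewrite ltnNge leq_addr.
rewrite mul1n.
have [sn tn] : (s <= n)%N /\ (t <= n)%N.
  by split; apply: leq_trans stn; rewrite ?leq_addr ?leq_addl.

pose A l u := if l == i then u == s else if l == j then u == t else (0 < u)%N.
have cA : #|[set a : {ffun 'I_k -> 'I_n.+1} | ((\sum_l a l)%N == n) && [forall l, A l (a l)]]|
    = ncomp (k - 2) (n - (s + t)).
  rewrite (@card_sum_coef _ n n A) (bigD1 i) //= (bigD1 j) 1?eq_sym //= /A.
  rewrite eqxx eq_sym (negPf ij) eqxx !sum_eqX // mulrA -exprD.
  rewrite (eq_bigr (fun=> posX n)) => [|l /andP[/negPf -> /negPf ->]] //.
  rewrite prodr_const coefXnM ltnNge stn /= coef_posX_exp ?leq_subr //.
  congr ncomp; have := cardC (pred2 i j); rewrite card2 ij card_ord.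
  move/(congr1 (subn^~ 2)); rewrite addKn => <-.
  by apply: eq_card => l; rewrite !inE negb_or.
rewrite -cA; apply: subset_leq_card; apply/subsetP => a.
rewrite !inE => /andP[/andP[-> /forallP a0] /andP[ai aj]] /=.
apply/forallP => l; rewrite /A.
by case: eqP => [->//|_]; case: eqP => [->//|_].
Qed.

End Compositions.

(** * Zero coordinates and parallel edges *)

Lemma leq_card_sum_cover (T I : finType) (P : pred I) (A : {set T}) (B : I -> {set T}) :
  {in A, forall x, exists2 i, P i & x \in B i} -> (#|A| <= \sum_(i | P i) #|B i|)%N.
Proof.
move=> AB; have -> : (\sum_(i | P i) #|B i| = \sum_(i | P i) \sum_(x in B i) 1)%N.
  by apply: eq_bigr => i _; rewrite sum1_card.
rewrite (exchange_big_dep xpredT) //= -sum1_card big_mkcond /=; apply: leq_sum => x _.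
case: ifP => // /AB[i Pi xBi].
by rewrite (bigD1 i) ?Pi.
Qed.

Definition at_most_one_zero n k : {set {ffun 'I_k -> 'I_n.+1}} :=
  [set a : {ffun 'I_k -> 'I_n.+1} | ((\sum_i a i)%N == n) &&
    [forall i, forall j, (i != j) ==> ((0 < a i) || (0 < a j))%N]].

Lemma card_at_most_one_zero n k :
  (#|at_most_one_zero n k| <= ncomp k n + k * ncomp k.-1 n)%N.
Proof.
rewrite -(cardsID (positive_compositions n k)) leq_add //.
  by rewrite -card_positive_compositions subset_leq_card // subsetIr.
pose B i := [set a : {ffun 'I_k -> 'I_n.+1} | ((\sum_j a j)%N == n) &&
  [forall j, if j == i then a j == 0 :> nat else (0 < a j)%N]].
have <- : (\sum_i #|B i| = k * ncomp k.-1 n)%N.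
  under eq_bigr do rewrite card_one_zero_compositions.
  by rewrite sum_nat_const card_ord.
apply: leq_card_sum_cover => a; rewrite !inE => /andP[+ /andP[sa /forallP az]].
rewrite sa negb_forall => /existsP[i]; rewrite -eqn0Ngt => /eqP ai.
exists i => //; rewrite inE sa /=; apply/forallP => j.
case: eqP => [->|/eqP ji]; first by rewrite ai.
by have /forallP/(_ i)/implyP/(_ ji) := az j; rewrite ai orbF.
Qed.

Definition proportional_compositions n k (i j : 'I_k) (p q : nat) :
    {set {ffun 'I_k -> 'I_n.+1}} :=
  [set a in positive_compositions n k |
    [exists g : 'I_n.+1, (a i == g * p :> nat)%N && (a j == g * q :> nat)%N]].

(** Comparison of a sum with an integral: by monotonicity, [d] copies of the term at [g] are at most
    the sum of [ncomp k.+1 m] over the block from [n - g * d] to [n - (g - 1) * d], and these blocks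
    are disjoint. *)
Lemma sum_ncomp_multiples k n d N :
  (d * (\sum_(1 <= g < N.+1 | g * d <= n) ncomp k.+1 (n - g * d))
   <= \sum_(n - N * d <= m < n) ncomp k.+1 m)%N.
Proof.
elim: N => [|N IH]; first by rewrite mul0n subn0 !big_geq // muln0.
rewrite big_mkcond big_nat_recr //= -big_mkcond /= mulnDr.
have le1 : (n - N.+1 * d <= n - N * d)%N by rewrite leq_sub2l // leq_mul2r leqnSn orbT.
rewrite (big_cat_nat le1) ?leq_subr //= addnC leq_add //.
have [dn|_] := leqP (N.+1 * d) n; last by rewrite muln0.
have {1}-> : d = (n - N * d - (n - N.+1 * d))%N.
  by rewrite mulSn in dn *; lia.
rewrite -sum_nat_const_nat big_nat_cond [leqRHS]big_nat_cond.
by apply: leq_sum => m /andP[/andP[mn _] _]; apply: leq_ncomp.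
Qed.

Lemma card_proportional_compositions n k (i j : 'I_k) p q :
    (2 < k)%N -> i != j -> (0 < p)%N ->
  ((p + q) * #|proportional_compositions n i j p q| <= ncomp k.-1 n)%N.
Proof.
move=> k2 ij p0; set H := proportional_compositions _ _ _ _ _.
pose B (g : nat) := [set a in positive_compositions n k |
  (a i == g * p :> nat)%N && (a j == g * q :> nat)%N].
have H1 : (#|H| <= \sum_(g < n.+1 | (0 < g)%N) #|B g|)%N.
  apply: leq_card_sum_cover => a; rewrite inE => /andP[ap /existsP[g ag]].
  exists g; last by rewrite inE ap.
  move: ap; rewrite inE => /andP[_ /forallP/(_ i)].
  by case/andP: ag => /eqP -> _; rewrite muln_gt0 => /andP[].
have H2 : (#|H| <= \sum_(1 <= g < n.+1 | g * (p + q) <= n) ncomp (k - 2) (n - g * (p + q)))%N.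
  apply: leq_trans H1 _.
  rewrite -(big_mkord (fun g => 0 < g)%N (fun g => #|B g|)).
  rewrite big_mkcond big_ltn //= add0n big_mkcond [leqRHS]big_mkcond.
  rewrite big_nat_cond [leqRHS]big_nat_cond; apply: leq_sum => g /andP[/andP[-> _] _].
  apply: leq_trans (card_compositions_fix2 _ _ _ ij) _; rewrite mulnDr.
  by have [_|_] := leqP (g * p + g * q) n; rewrite ?mul1n.
apply: leq_trans (leq_mul (leqnn _) H2) _.
(* As [k] is at least 3, at least one part stays free, so that [ncomp (k - 2)] is monotone. *)
case: k k2 {H H1 H2 B i j ij} => [|[|[|k]]] // _.
rewrite !subSS subn0 /= -/(ncomp k.+2 n); apply: leq_trans (sum_ncomp_multiples _ _ _ _) _.
(* The blocks cover a final segment of the integers below [n]; the sum over all of them is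
   [ncomp k.-1 n]. *)
rewrite ncompS -(big_mkord xpredT) /= (@big_cat_nat _ _ _ (n - n * (p + q)) 0) ?leq_subr //=.
exact: leq_addl.
Qed.

Definition parallel_compositions n k (i j : 'I_k) :
    {set {ffun 'I_k -> 'I_n.+1} * {ffun 'I_k -> 'I_n.+1}} :=
  [set ab | [&& ab.1 \in positive_compositions n k, ab.2 \in positive_compositions n k
    & (ab.1 i * ab.2 j == ab.2 i * ab.1 j)%N]].

(** Take for [(p, q)] the primitive vector of [(a i, a j)]. Since [p] and [q] are coprime, Gauss's
    lemma makes [(b i, b j)] a multiple of it too. Summing over all [(p, q)], coprime or not, only
    enlarges the bound. *)
Lemma card_parallel_compositions n k (i j : 'I_k) :
  (#|parallel_compositions n i j| <=
   \sum_(p < n.+1 | 0 < p) \sum_(q < n.+1 | 0 < q) #|proportional_compositions n i j p q| ^ 2)%N.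
Proof.
rewrite pair_big /=.
under eq_bigr => pq _ do rewrite -mulnn -cardsX.
apply: leq_card_sum_cover => -[a b]; rewrite inE /= => /and3P[ap bp /eqP ab].
have := ap; have := bp; rewrite !inE => /andP[_ /forallP b0] /andP[_ /forallP a0].
set g := gcdn (a i) (a j).
have g0 : (0 < g)%N by rewrite gcdn_gt0 a0.
have gi : (g %| a i)%N := dvdn_gcdl _ _.
have gj : (g %| a j)%N := dvdn_gcdr _ _.
have lt_div (x : 'I_n.+1) e : (x %/ e < n.+1)%N := leq_ltn_trans (leq_div _ _) (ltn_ord x).
pose p := Ordinal (lt_div (a i) g); pose q := Ordinal (lt_div (a j) g).
have cpq : coprime p q.
  by rewrite /coprime -(eqn_pmul2r g0) muln_gcdl !divnK // mul1n.
have p0 : (0 < p)%N by rewrite divn_gt0 // dvdn_leq.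
have q0 : (0 < q)%N by rewrite divn_gt0 // dvdn_leq.
have {}ab : (p * b j = b i * q)%N.
  by apply/eqP; rewrite -(eqn_pmul2r g0) -mulnA [(b j * g)%N]mulnC mulnA divnK // ab -mulnA divnK.
have pb : (p %| b i)%N by rewrite -(Gauss_dvdl _ cpq) -ab dvdn_mulr.
exists (p, q) => /=; first by rewrite p0 q0.
have gn : (g < n.+1)%N by apply: leq_ltn_trans (ltn_ord (a i)); apply: dvdn_leq (a0 i) gi.
rewrite in_setX; apply/andP; split; rewrite inE ?ap ?bp; apply/existsP.
  by exists (Ordinal gn) => /=; rewrite ![(g * _)%N]mulnC !divnK // !eqxx.
exists (Ordinal (lt_div (b i) p)) => /=; rewrite divnK // eqxx /=.
by rewrite -(eqn_pmul2l p0) mulnA [(p * (b i %/ p))%N]mulnC divnK // ab.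
Qed.

Definition nonparallel_compositions n k :
    {set {ffun 'I_k -> 'I_n.+1} * {ffun 'I_k -> 'I_n.+1}} :=
  [set ab : {ffun 'I_k -> 'I_n.+1} * {ffun 'I_k -> 'I_n.+1} |
    [&& ((\sum_i ab.1 i)%N == n), ((\sum_i ab.2 i)%N == n),
    [forall i, (0 < ab.1 i) || (0 < ab.2 i)]%N &
    [forall i, forall j, (i != j) ==> (ab.1 i * ab.2 j != ab.2 i * ab.1 j)%N]]].

(** Two zeros on the same axis, at [i] and [j], would make both products in the parallelism test
    vanish. *)
Lemma card_nonparallel_le n k :
  (#|nonparallel_compositions n k| <= (ncomp k n + k * ncomp k.-1 n) ^ 2)%N.
Proof.
apply: (@leq_trans (#|setX (at_most_one_zero n k) (at_most_one_zero n k)|)); last first.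
  by rewrite cardsX mulnn leq_sqr card_at_most_one_zero.
apply: subset_leq_card; apply/subsetP => -[a b].
rewrite !inE /= => /and4P[-> -> _ /forallP ab] /=; apply/andP; split;
  apply/forallP => i; apply/forallP => j; apply/implyP => ij;
  have /forallP/(_ j)/implyP/(_ ij) := ab i; apply: contraNT;
  by rewrite negb_or -!eqn0Ngt => /andP[/eqP -> /eqP ->]; rewrite !(mul0n, muln0).
Qed.

Lemma positive_or_parallel n k a b :
  a \in positive_compositions n k -> b \in positive_compositions n k ->
  (a, b) \in nonparallel_compositions n k \/
  exists2 ij : 'I_k * 'I_k, ij.1 != ij.2 & (a, b) \in parallel_compositions n ij.1 ij.2.
Proof.
move=> ap bp; have := ap; have := bp.
rewrite !inE => /andP[sb /forallP b0] /andP[sa /forallP a0] /=.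
rewrite sa sb /=; have -> /= : [forall i, (0 < a i) || (0 < b i)]%N.
  by apply/forallP => i; rewrite a0.
have [|] := boolP [forall i, forall j, (i != j) ==> (a i * b j != b i * a j)%N]; first by left.
rewrite negb_forall => /existsP[i]; rewrite negb_forall => /existsP[j].
rewrite negb_imply negbK => /andP[ij abij]; right; exists (i, j) => //.
by rewrite !inE /= sa sb abij !andbT; apply/andP; split; apply/forallP.
Qed.

Lemma card_nonparallel_ge n k :
  (ncomp k n ^ 2 <= #|nonparallel_compositions n k|
   + \sum_(ij : 'I_k * 'I_k | ij.1 != ij.2) #|parallel_compositions n ij.1 ij.2|)%N.
Proof.
rewrite -card_positive_compositions -mulnn -cardsX.
rewrite -(cardsID (nonparallel_compositions n k) (setX _ _)) leq_add //.
  by rewrite subset_leq_card // subsetIr.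
apply: leq_card_sum_cover => -[a b]; rewrite in_setD in_setX => /andP[nab /andP[ap bp]].
by have [|//] := positive_or_parallel ap bp; rewrite (negPf nab).
Qed.

Lemma ord2_cover (i j l : 'I_2) : i != j -> (l == i) || (l == j).
Proof. by case: i j l => -[|[|//]] ? [[|[|//]] ?] [[|[|//]] ?]; rewrite -!val_eqE. Qed.

(** With two parts, fixing both leaves none free and the monotonicity argument is lost. Instead,
    parallel edges together with equal sums force [a = b], so the bad pairs lie on the diagonal. *)
Lemma card_nonparallel_ge2 n :
  (0 < n)%N -> (ncomp 2 n ^ 2 <= #|nonparallel_compositions n 2| + ncomp 2 n)%N.
Proof.
move=> n0; rewrite -card_positive_compositions -mulnn -cardsX.
rewrite -(cardsID (nonparallel_compositions n 2) (setX _ _)) leq_add //.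
  by rewrite subset_leq_card // subsetIr.
rewrite -(card_imset (positive_compositions n 2) (f := fun a => (a, a))); last by move=> a b [].
apply: subset_leq_card; apply/subsetP => -[a b].
rewrite in_setD in_setX => /andP[nab /andP[ap bp]].
have [|] := positive_or_parallel ap bp; first by rewrite (negPf nab).
case=> -[i j] /= ij; rewrite inE => /and3P[_ _ /= /eqP abij].
suff /ffunP -> : a =1 b by apply: imset_f.
have sum2 (c : {ffun 'I_2 -> 'I_n.+1}) : c \in positive_compositions n 2 -> (c i + c j = n)%N.
  rewrite inE => /andP[/eqP sc _]; rewrite -[RHS]sc (bigD1 i) //= (bigD1 j) 1?eq_sym //=.
  rewrite big1 ?addn0 // => l /andP[li lj].
  by have := ord2_cover l ij; rewrite (negPf li) (negPf lj).
have sa := sum2 _ ap; have sb := sum2 _ bp.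
(* Both sides are multiplied by [n], written as [b i + b j] on the left and as [a i + a j] on the
   right. *)
have abi : (a i = b i :> nat).
  apply/eqP; rewrite -(eqn_pmul2r n0); apply/eqP.
  transitivity (a i * (b i + b j))%N; first by rewrite sb.
  by rewrite mulnDr abij mulnC -mulnDr sa.
have abj : (a j = b j :> nat) by apply/eqP; rewrite -(eqn_add2l (a i)) sa abi sb.
move=> l; apply: val_inj => /=.
by have /orP[/eqP ->|/eqP ->] := ord2_cover l ij.
Qed.

(** * From chains to sequences of edge vectors *)

Section Chains.
Variables (n k : nat).
Local Notation box := ('I_n.+1 * 'I_n.+1)%type.

Definition edge_of (d : box) : int * int := ((d.1 : nat)%:Z, (d.2 : nat)%:Z).

Lemma edge_of_inj : injective edge_of.
Proof. by move=> [a b] [c d] [/val_inj -> /val_inj ->]. Qed.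

Definition slope_of (d : box) : \bar rat := slope (edge_of d).

(** Cross-multiplication, valid for infinite slopes as well: a nonzero vector with first coordinate
    0 has a positive second one. *)
Lemma slope_of_eq (d d' : box) :
  (0 < d.1)%N || (0 < d.2)%N -> (0 < d'.1)%N || (0 < d'.2)%N ->
  (slope_of d == slope_of d') = (d.1 * d'.2 == d'.1 * d.2)%N.
Proof.
case: d d' => [a b] [c e] /=; rewrite /slope_of /slope /= -!pmulrn.
rewrite !eqz_nat !eqn0Ngt; case: (posnP a) => [->|a0]; case: (posnP c) => [->|c0] //=.
- by rewrite mul0n [RHS]eq_sym muln_eq0 => b0 _; rewrite !eqn0Ngt c0 b0.
- by rewrite mul0n muln_eq0 => _ e0; rewrite !eqn0Ngt a0 e0.
move=> _ _; rewrite eqe eqr_div ?pnatr_eq0 -?lt0n // -!natrM eqr_nat.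
by rewrite eq_sym mulnC [(b * _)%N]mulnC.
Qed.

Lemma quarter_plane_edge_of (d : box) :
  quarter_plane_edge (edge_of d) = ((0 < d.1) || (0 < d.2))%N.
Proof.
by rewrite /quarter_plane_edge !lez_nat !leq0n !andbT xpair_eqE negb_and !lt0n.
Qed.

Lemma sum_edge_of (s : seq box) :
  \sum_(d <- s) edge_of d = ((\sum_(d <- s) d.1)%N%:Z, (\sum_(d <- s) d.2)%N%:Z).
Proof.
elim: s => [|d s IH]; first by rewrite !big_nil.
by rewrite !big_cons IH !PoszD.
Qed.

(** Vertices are the partial sums of the edges, so that [edges] inverts this map. *)
Definition chain_of (s : seq box) : seq (int * int) := 0 :: scanl +%R 0 (map edge_of s).

Lemma edges_chain_of s : edges (chain_of s) = map edge_of s.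
Proof. by rewrite /edges /= scanlK // => x y; rewrite addrAC subrr add0r. Qed.

Lemma last_scanl_add (x : int * int) s : last x (scanl +%R x s) = x + \sum_(y <- s) y.
Proof.
elim: s x => [|y s IH] x /=; first by rewrite big_nil addr0.
by rewrite IH big_cons addrA.
Qed.

Definition edge_tuples : {set k.-tuple box} :=
  [set t : k.-tuple box | [&& \sum_(d <- t) edge_of d == (n%:Z, n%:Z),
    all (fun d : box => (0 < d.1) || (0 < d.2))%N t & uniq (map slope_of t)]].

Definition sorted_edge_tuples : {set k.-tuple box} :=
  [set t : k.-tuple box in edge_tuples | sorted <%O (map slope_of t)].

Lemma chain_ofP v : lattice_convex_chain n k v <->
  exists2 t : k.-tuple box, t \in sorted_edge_tuples & v = chain_of t.
Proof.
split=> [|[t + ->]]; last first.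
  rewrite !inE => /andP[/and3P[/eqP st pt _] srt]; split.
  - by rewrite /= size_scanl size_map size_tuple.
  - by [].
  - by rewrite /chain_of [last _ _]last_scanl_add add0r big_map.
  - by rewrite edges_chain_of all_map (eq_all quarter_plane_edge_of).
  - by rewrite edges_chain_of -map_comp.
case: v => [[]//|u w] [/= [sw] u0 lw]; rewrite u0 => qw srt.
set e := pairmap _ _ _ in qw srt.
have we : w = scanl +%R 0 e.
  by rewrite pairmapK // => x y; rewrite addrC subrK.
have se : \sum_(y <- e) y = (n%:Z, n%:Z) by rewrite -lw we u0 last_scanl_add add0r.
(* [inord] loses nothing here: the edges have nonnegative coordinates and sum to [(n, n)], so each
   coordinate is at most [n]. *)
pose f (d : int * int) : box := (inord `|d.1|%N, inord `|d.2|%N).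
have fK : {in e, forall d, edge_of (f d) = d}.
  move=> d de; have {}qw : forall x, x \in e -> 0 <= x.1 /\ 0 <= x.2.
    by move=> x /(allP qw)/and3P[].
  have d1n : d.1 <= n%:Z.
    have -> : n%:Z = \sum_(y <- e) y.1 by rewrite -(raddf_sum fst) se.
    rewrite (big_rem d) //= lerDl big_seq sumr_ge0 // => x /mem_rem/qw[].
    by [].
  have d2n : d.2 <= n%:Z.
    have -> : n%:Z = \sum_(y <- e) y.2 by rewrite -(raddf_sum snd) se.
    rewrite (big_rem d) //= lerDl big_seq sumr_ge0 // => x /mem_rem/qw[].
    by [].
  have [] := qw _ de; case: d {de} d1n d2n => -[x|//] [y|//] /=; rewrite !lez_nat => xn yn _ _.
  by rewrite /edge_of /f /= !inordK.
have eE : map edge_of (map f e) = e.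
  by rewrite -map_comp -[RHS]map_id; apply/eq_in_map => d /fK.
have sz : size (map f e) == k by rewrite size_map size_pairmap sw.
exists (Tuple sz); last by rewrite /chain_of /= eE -we.
have slE : map slope_of (map f e) = map slope e by rewrite -[in RHS]eE -[RHS]map_comp.
rewrite !inE /= slE srt -(big_map edge_of xpredT id) eE se eqxx /= andbT.
rewrite -(eq_all quarter_plane_edge_of) -(all_map edge_of) eE qw.
exact: lt_sorted_uniq.
Qed.

Lemma num_chainsE : num_chains n k = #|sorted_edge_tuples|.
Proof.
pose s := [seq chain_of t | t : k.-tuple box in sorted_edge_tuples].
have us : uniq s.
  rewrite map_inj_in_uniq ?enum_uniq // => t u _ _ tu; apply/val_inj.
  by apply: (inj_map edge_of_inj); rewrite -!edges_chain_of tu.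
have -> : num_chains n k = size s.
  rewrite -(undup_id us) -card_fseq /num_chains -(set_fsetK [fset x in s]%fset).
  congr #|` fset_set _|.
  have sE v : (v \in [fset x in s]%fset) = (v \in s) by rewrite in_fset.
  apply/seteqP; split=> v /=; rewrite sE.
    by move=> /chain_ofP[t ts ->]; apply: fintype.image_f.
  by move=> /fintype.imageP[t ts ->]; apply/chain_ofP; exists t.
by rewrite size_map cardE.
Qed.

(** The tuples are grouped by their sorted rearrangement. Slopes are distinct, so each fibre
    consists of the [k!] permutations of a duplicate-free tuple. *)
Lemma card_edge_tuples : #|edge_tuples| = (k`! * #|sorted_edge_tuples|)%N.
Proof.
pose le_slope (d d' : box) := (slope_of d <= slope_of d')%O.
pose lt_slope (d d' : box) := (slope_of d < slope_of d')%O.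
have srt t : uniq (map slope_of t) -> sorted lt_slope (sort le_slope t).
  move=> ut; have := sort_lt_sorted (map slope_of t); rewrite ut.
  by rewrite -(map_sort (leT' := le_slope)) // sorted_map.
have edge_perm (t u : k.-tuple box) : perm_eq t u -> (t \in edge_tuples) = (u \in edge_tuples).
  move=> tu; rewrite !inE (perm_big _ tu) (perm_all _ tu).
  by rewrite (perm_uniq (perm_map _ tu)).
rewrite mulnC -sum_nat_const -sum1_card.
rewrite (partition_big (fun t => sort_tuple le_slope t) (mem sorted_edge_tuples)) /=; last first.
  move=> t tE; rewrite inE (edge_perm _ t) ?perm_sort // tE sorted_map.
  by move: tE; rewrite !inE => /and3P[_ _] /srt.
apply: eq_bigr => s; rewrite inE => /andP[sE ss].
have us : uniq s by move: sE; rewrite inE => /and3P[_ _] /map_uniq.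
rewrite -[in RHS](size_tuple s) -size_permutations //.
rewrite (eq_bigl (mem [set t : k.-tuple box | perm_eq t s])) => [|t].
  rewrite sum1_card cardE -(size_map val); apply: perm_size.
  apply: uniq_perm; first by rewrite map_inj_uniq ?enum_uniq //; apply: val_inj.
    exact: permutations_uniq.
  move=> x; rewrite mem_permutations; apply/mapP/idP => [[t]|xs].
    by rewrite mem_enum inE => ts ->.
  have sx : size x == k by rewrite (perm_size xs) size_tuple.
  by exists (Tuple sx) => //; rewrite mem_enum inE.
rewrite !inE; apply/andP/idP => [[_ /eqP <-]|ts]; first by rewrite perm_sym perm_sort.
have tE : t \in edge_tuples by rewrite (edge_perm _ s).
split; first by move: tE; rewrite inE.
(* Two strictly sorted sequences with the same elements coincide. *)
apply/eqP/val_inj; apply: (@irr_sorted_eq _ lt_slope).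
- by move=> y x z; apply: lt_trans.
- by move=> x; apply: ltxx.
- by apply: srt; move: tE; rewrite inE => /and3P[].
- by rewrite -sorted_map.
by apply: perm_mem; rewrite perm_sort.
Qed.

(** A sequence of pairs is the same as a pair of sequences, and distinct slopes amount to nonzero
    cross products. *)
Lemma card_edge_tuplesE : #|edge_tuples| = #|nonparallel_compositions n k|.
Proof.
pose f (t : k.-tuple box) : {ffun 'I_k -> 'I_n.+1} * {ffun 'I_k -> 'I_n.+1} :=
  ([ffun i => (tnth t i).1], [ffun i => (tnth t i).2]).
pose g (ab : {ffun 'I_k -> 'I_n.+1} * {ffun 'I_k -> 'I_n.+1}) : k.-tuple box :=
  [tuple (ab.1 i, ab.2 i) | i < k].
have fK : cancel f g.
  by move=> t; apply: eq_from_tnth => i; rewrite tnth_mktuple !ffunE -surjective_pairing.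
have gK : cancel g f.
  by move=> [a b]; congr pair; apply/ffunP => i; rewrite ffunE tnth_mktuple.
rewrite -(on_card_preimset (f := f)); last by apply: onW_bij; exists g.
apply: eq_card => t; rewrite !inE /= sum_edge_of xpair_eqE !eqz_nat !big_tuple -andbA.
do 2![congr andb; first by congr (_ == _); apply: eq_bigr => i _; rewrite ffunE].
have -> : all (fun d : box => (0 < d.1) || (0 < d.2))%N t =
    [forall i, (0 < [ffun i => (tnth t i).1] i) || (0 < [ffun i => (tnth t i).2] i)]%N.
  by apply/all_tnthP/forallP => h i; have := h i; rewrite !ffunE.
apply: andb_id2l => /forallP t0.
have {}t0 i : ((0 < (tnth t i).1) || (0 < (tnth t i).2))%N by have := t0 i; rewrite !ffunE.
apply/(tuple_uniqP (map_tuple slope_of t))/forallP => [h i|h i j].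
  apply/forallP => j; apply/implyP; apply: contraNN; rewrite !ffunE => ij.
  by apply/eqP/h; rewrite !tnth_map; apply/eqP; rewrite slope_of_eq // [X in _ == X]mulnC.
rewrite !tnth_map => /eqP; rewrite slope_of_eq // [X in _ == X]mulnC => ij; apply/eqP.
have /forallP/(_ j) := h i; rewrite !ffunE ij.
by case: eqP.
Qed.

Lemma num_chains_nonparallel :
  (k`! * num_chains n k = #|nonparallel_compositions n k|)%N.
Proof. by rewrite num_chainsE -card_edge_tuples card_edge_tuplesE. Qed.

End Chains.

(** * Real estimates of the error terms *)

Section Estimates.
Variable R : realType.

Lemma sum_inv_sqr_le (p n : nat) : (0 < p)%N ->
  \sum_(1 <= q < n.+1) ((p + q)%:R ^- 2 : R) <= p%:R^-1.
Proof.
(* The strengthened bound telescopes, since 1/m - 1/(m+1) exceeds 1/(m+1)^2 by 1/(m(m+1)^2). *)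
move=> p0; suff: \sum_(1 <= q < n.+1) ((p + q)%:R ^- 2 : R) <= p%:R^-1 - (p + n)%:R^-1.
  by move/le_trans; apply; rewrite lerBlDr lerDl invr_ge0.
elim: n => [|n IH]; first by rewrite big_geq // addn0 subrr.
rewrite big_nat_recr //=; apply: le_trans (lerD IH (lexx _)) _.
rewrite addnS; set m := (p + n)%N; have m0 : 0 < m%:R :> R by rewrite ltr0n addn_gt0 p0.
have m1 : 0 < m.+1%:R :> R by rewrite ltr0n.
suff : 0 <= m%:R^-1 - m.+1%:R^-1 - m.+1%:R ^- 2 :> R.
  by move: (_ ^- 2) (m.+1%:R^-1) (m%:R^-1) (p%:R^-1) => u v w z; lra.
have -> : m%:R^-1 - m.+1%:R^-1 - m.+1%:R ^- 2 = (m%:R * m.+1%:R ^+ 2)^-1 :> R.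
  rewrite -natr1 in m1 *; by field; rewrite !lt0r_neq0.
by rewrite invr_ge0 mulr_ge0 ?exprn_ge0 // ltW.
Qed.

Lemma harmonic_le (n : nat) : (0 < n)%N ->
  \sum_(1 <= p < n.+1) (p%:R^-1 : R) <= 1 + ln n%:R.
Proof.
case: n => // n _; elim: n => [|n IH]; first by rewrite big_nat1 invr1 ln1 addr0.
rewrite big_nat_recr //=; apply: le_trans (lerD IH (lexx _)) _.
rewrite -addrA lerD2l.
have n0 : 0 < n.+1%:R :> R by rewrite ltr0n.
have n1 : 0 < n.+2%:R :> R by rewrite ltr0n.
have h : 1 + (- n.+2%:R^-1) = n.+1%:R / n.+2%:R :> R.
  by rewrite -(natr1 n.+1) in n1 *; field; rewrite lt0r_neq0.
(* The inequality ln(1 + x) <= x at x = -1/(n+2) bounds the new term by an increment of the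
   logarithm. *)
have := @le_ln1Dx R (- n.+2%:R^-1); rewrite h ln_div ?posrE // => hl.
suff : ln n.+1%:R - ln n.+2%:R <= - n.+2%:R^-1 :> R.
  by move: (_^-1) (ln _) (ln _) => u v w; lra.
by apply: hl; rewrite ltrN2 invf_cp1 // ltr1n.
Qed.

(** Each cardinal is at most [c / (p + q)]; the sum of squares over [q] costs 1/p, and the sum over
    [p] is harmonic. *)
Lemma sum_proportional_le n k (i j : 'I_k) : (0 < n)%N -> (2 < k)%N -> i != j ->
  (\sum_(p < n.+1 | (0 < p)%N) \sum_(q < n.+1 | (0 < q)%N)
     #|proportional_compositions n i j p q| ^ 2)%N%:R
  <= (ncomp k.-1 n)%:R ^+ 2 * (1 + ln n%:R) :> R.
Proof.
move=> n0 k2 ij; set c : R := (ncomp k.-1 n)%:R.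
have sum1E (F : nat -> R) : \sum_(p < n.+1 | (0 < p)%N) F p = \sum_(1 <= p < n.+1) F p.
  rewrite -(big_mkord (fun p => 0 < p)%N F) big_mkcond big_ltn //= add0r.
  rewrite big_nat_cond [RHS]big_nat_cond.
  by apply: eq_bigr => p /andP[/andP[-> _] _].
apply: (@le_trans _ _ (\sum_(p < n.+1 | (0 < p)%N) c ^+ 2 * p%:R^-1)); last first.
  rewrite -mulr_sumr ler_wpM2l ?exprn_ge0 //.
  by rewrite (sum1E (fun p => p%:R^-1)) harmonic_le.
rewrite natr_sum ler_sum // => p p0; rewrite natr_sum.
apply: (@le_trans _ _ (\sum_(q < n.+1 | (0 < q)%N) c ^+ 2 * (p + q)%:R ^- 2)); last first.
  rewrite -mulr_sumr ler_wpM2l ?exprn_ge0 //.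
  by rewrite (sum1E (fun q => (p + q)%:R ^- 2)) sum_inv_sqr_le.
apply: ler_sum => q q0.
have pq : 0 < (p + q)%:R :> R by rewrite ltr0n addn_gt0 p0.
rewrite ler_pdivlMr ?exprn_gt0 // natrX -exprMn lerXn2r ?nnegrE ?mulr_ge0 //.
by rewrite mulrC -natrM ler_nat card_proportional_compositions.
Qed.

(** Consecutive binomials satisfy (k-1) C(n-1,k-1) = (n-k+1) C(n-1,k-2), and [2 * k <= n] gives n <=
    2(n-k+1). *)
Lemma ncomp_ratio n k : (0 < n)%N -> (0 < k)%N -> (2 * k <= n)%N ->
  (n * ncomp k.-1 n <= 2 * k * ncomp k n)%N.
Proof.
case: n k => // n [|[|k]] // _ _ kn /=; first by rewrite muln0.
apply: (@leq_trans (2 * (n - k) * 'C(n, k))); first by rewrite leq_mul2r; lia.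
by rewrite -mulnA -mul_bin_left mulnA leq_mul2r; lia.
Qed.

(** Here [d] is the target accuracy, and the last hypothesis is the fourth power of k <= d n^(1/2) /
    (ln n)^(1/4). With x = k^2/n it reads x^2 ln n <= d^4, whence x <= d^2 <= d/2. *)
Lemma num_chains_estimate (n k : nat) (d : R) :
    (0 < n)%N -> (0 < k)%N -> 0 < d -> d <= 2^-1 -> 1 <= ln (n%:R : R) ->
    1 <= d * (n - 1)%:R -> k%:R ^+ 4 * ln (n%:R : R) <= d ^+ 4 * n%:R ^+ 2 ->
  `|(k`! * num_chains n k)%N%:R - (ncomp k n)%:R ^+ 2| <= 3 * d * (ncomp k n)%:R ^+ 2.
Proof.
move=> n0 k0 d0 d2 ln1 dn kn.
have n0R : 0 < n%:R :> R by rewrite ltr0n.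
set x : R := k%:R ^+ 2 / n%:R.
have x0 : 0 <= x by rewrite divr_ge0 ?exprn_ge0.
have x2 : x ^+ 2 * ln n%:R <= d ^+ 4.
  by rewrite expr_div_n -exprM mulrAC ler_pdivrMr ?exprn_gt0.
have x1 : x <= d ^+ 2.
  rewrite -(@ler_pXn2r _ 2) ?nnegrE ?exprn_ge0 ?(ltW d0) // -exprM.
  by apply: le_trans x2; rewrite ler_peMr ?exprn_ge0.
have xd : x <= d / 2 by nra.
have kn2 : (2 * k <= n)%N.
  rewrite -(ler_nat R) natrM.
  have : k%:R ^+ 2 <= d / 2 * n%:R by rewrite -ler_pdivrMr.
  have : 1 <= k%:R :> R by rewrite ler1n.
  nra.
set s : R := (ncomp k n)%:R; set c : R := (ncomp k.-1 n)%:R.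
have s0 : 0 <= s by []. have c0 : 0 <= c by [].
have cs : n%:R * c <= 2 * k%:R * s by rewrite -!natrM ler_nat ncomp_ratio.
have kcs : k%:R * c <= 2 * x * s.
  have -> : 2 * x * s = k%:R * (2 * k%:R * s) / n%:R by rewrite /x; field; rewrite lt0r_neq0.
  by rewrite ler_pdivlMr // -[leLHS]mulrA [c * _]mulrC ler_wpM2l.
(* The upper bound is s^2 (1 + 2x)^2 <= s^2 (1 + d)^2 <= s^2 (1 + 3d). *)
have up : (k`! * num_chains n k)%N%:R <= (s + k%:R * c) ^+ 2.
  by rewrite -natrM -natrD -natrX ler_nat num_chains_nonparallel card_nonparallel_le.
have {}up : (k`! * num_chains n k)%N%:R <= s ^+ 2 + 3 * d * s ^+ 2.
  apply: le_trans up _; apply: (@le_trans _ _ ((s + d * s) ^+ 2)).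
    rewrite lerXn2r ?nnegrE ?addr_ge0 ?mulr_ge0 ?(ltW d0) // lerD2l.
    by apply: le_trans kcs _; rewrite ler_wpM2r //; lra.
  have -> : (s + d * s) ^+ 2 = s ^+ 2 + (2 * d + d ^+ 2) * s ^+ 2 by ring.
  by rewrite lerD2l ler_wpM2r ?exprn_ge0 //; nra.
suff lo : s ^+ 2 <= (k`! * num_chains n k)%N%:R + 3 * d * s ^+ 2.
  by rewrite ler_norml; apply/andP; split; lra.
have [k2|k2|k2] := ltngtP k 2.
(* A single edge has no other to be parallel to, so the error sum is empty. *)
- have k1 : k = 1%N by apply/eqP; rewrite eqn_leq -ltnS k2 k0.
  have ord_eq0 (i : 'I_k) : i = 0 :> nat.
    by case: i => i ik /=; apply/eqP; rewrite -leqn0 -ltnS -k1.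
  rewrite -natrX; apply: (@le_trans _ _ (k`! * num_chains n k)%N%:R); last first.
    by rewrite lerDl !mulr_ge0 // ltW.
  rewrite ler_nat num_chains_nonparallel; apply: leq_trans (card_nonparallel_ge _ _) _.
  rewrite big_pred0 ?addn0 // => -[i j] /=; apply/negbTE; rewrite negbK; apply/eqP.
  by apply: val_inj; rewrite /= !ord_eq0.
(* For [k] at least 3 there are at most k^2 ordered pairs of indices, and the loss is at most
   (2xs)^2 (2 ln n) = 8 x^2 ln n s^2 <= 8 d^4 s^2 <= d s^2, as d <= 1/2. *)
- apply: (@le_trans _ _ ((k`! * num_chains n k)%N%:R +
    k%:R ^+ 2 * (c ^+ 2 * (1 + ln n%:R)))).
    apply: (@le_trans _ _ ((k`! * num_chains n k)%N%:R +
      \sum_(ij : 'I_k * 'I_k) c ^+ 2 * (1 + ln n%:R))).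
      rewrite -natrX num_chains_nonparallel.
      apply: (@le_trans _ _ (_ + _)%N%:R); first by rewrite ler_nat; apply: card_nonparallel_ge.
      rewrite natrD lerD2l natr_sum big_mkcond ler_sum // => -[i j] _ /=.
      case: ifP => [ij|_]; last by rewrite mulr_ge0 ?exprn_ge0 //; lra.
      apply: le_trans (sum_proportional_le n0 k2 ij).
      by rewrite ler_nat card_parallel_compositions.
    by rewrite lerD2l sumr_const card_prod card_ord -[_ *+ (k * k)]mulr_natl natrM expr2.
  rewrite lerD2l mulrA -exprMn; apply: (@le_trans _ _ ((2 * x * s) ^+ 2 * (2 * ln n%:R))).
    apply: ler_pM; rewrite ?exprn_ge0 ?mulr_ge0 //; try lra.
    by rewrite lerXn2r ?nnegrE ?mulr_ge0.
  have -> : (2 * x * s) ^+ 2 * (2 * ln n%:R) = (8 * (x ^+ 2 * ln n%:R)) * s ^+ 2 by ring.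
  rewrite ler_wpM2r ?exprn_ge0 //; apply: le_trans (_ : 8 * d ^+ 4 <= _); first lra.
  have -> : d ^+ 4 = d * (d * d ^+ 2) by ring.
  have d22 : d ^+ 2 <= 4^-1 by nra.
  nra.
(* For [k = 2] the loss is s = n - 1, which [dn] bounds by d s^2. *)
- have sn : s = (n - 1)%:R.
    by rewrite /s k2; case: (n) n0 => // m _ /=; rewrite bin1 subn1.
  have : s ^+ 2 <= (k`! * num_chains n k)%N%:R + s.
    by rewrite /s num_chains_nonparallel -natrX -natrD ler_nat k2 card_nonparallel_ge2.
  move/le_trans; apply; rewrite lerD2l expr2 mulrA ler_peMl //.
  by rewrite sn -mulrA mulr_natl; nra.
Qed.

End Estimates.

(** * The uniform asymptotic formula *)

Local Open Scope classical_set_scope.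

Theorem theorem4 (R : realType) (K : nat -> R)
    (hK : K =o_\oo
      (fun n : nat => (n%:R : R) `^ 2^-1 / (ln (n%:R : R)) `^ 4^-1)) :
  forall eps : R, 0 < eps ->
    \forall n \near \oo, forall k : nat, (0 < k)%N -> k%:R <= K n ->
      let main : R := k`!%:R^-1 * 'C(n - 1, k - 1)%:R ^+ 2 in
      `|(num_chains n k)%:R - main| <= eps * main.
Proof.
move=> eps eps0.
(* The estimate has relative error 3d, hence the third of [eps]. *)
pose d : R := Num.min 2^-1 (eps / 3).
have d0 : 0 < d by rewrite lt_min invr_gt0 ltr0n divr_gt0.
have d2 : d <= 2^-1 by rewrite ge_min lexx.
have d3 : 3 * d <= eps by rewrite mulrC -ler_pdivlMr // ge_min lexx orbT.
have /eqoP/(_ d d0) nearK := hK.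
(* The threshold for [n] is fixed before [k] is introduced, which gives uniformity. *)
near=> n => k k0 kK /=.
have en : expR 1 <= n%:R :> R by near: n; apply: nbhs_infty_ger.
have dn' : 1 + d^-1 <= n%:R :> R by near: n; apply: nbhs_infty_ger.
have n0R : 0 < n%:R :> R by apply: lt_le_trans en; apply: expR_gt0.
have n0 : (0 < n)%N by rewrite -(ltr0n R).
have ln1 : 1 <= ln (n%:R : R) by rewrite -[leLHS]expRK ler_ln ?posrE ?expR_gt0.
have ln0 : 0 <= ln (n%:R : R) by lra.
have dn : 1 <= d * (n - 1)%:R.
  by rewrite mulrC -ler_pdivrMr // div1r natrB //; lra.
have kf : k%:R <= d * ((n%:R : R) `^ 2^-1 / (ln (n%:R : R)) `^ 4^-1).
  apply: le_trans kK _; apply: le_trans (ler_norm _) _.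
  have -> : n%:R `^ 2^-1 / ln n%:R `^ 4^-1 = `|n%:R `^ 2^-1 / ln n%:R `^ 4^-1| :> R.
    by rewrite ger0_norm // divr_ge0 ?powR_ge0.
  by near: n.
(* Fourth powers clear both the square root and the fourth root. *)
have kn : k%:R ^+ 4 * ln (n%:R : R) <= d ^+ 4 * n%:R ^+ 2.
  have n4 : ((n%:R : R) `^ 2^-1) ^+ 4 = n%:R ^+ 2.
    by rewrite powR12_sqrt // -[4%N]/(2 * 2)%N exprM sqr_sqrtr.
  have l4 : ((ln (n%:R : R)) `^ 4^-1) ^+ 4 = ln (n%:R : R).
    by rewrite -powR_mulrn ?powR_ge0 // -powRrM mulVf // powRr1.
  have : k%:R ^+ 4 <= (d * ((n%:R : R) `^ 2^-1 / (ln (n%:R : R)) `^ 4^-1)) ^+ 4.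
    by rewrite lerXn2r ?nnegrE // (le_trans _ kf).
  rewrite !exprMn exprVn n4 l4 mulrA ler_pdivlMr //; lra.
have := num_chains_estimate n0 k0 d0 d2 ln1 dn kn.
have -> : ncomp k n = 'C(n - 1, k - 1).
  by case: (k) k0 => // k' _; case: (n) n0 => // n' _; rewrite !subn1.
set s : R := 'C(_, _)%:R => est.
have f0 : 0 < k`!%:R :> R by rewrite ltr0n fact_gt0.
rewrite -(ler_pM2l f0) -{1}(gtr0_norm f0) -normrM mulrBr mulrA mulfV ?lt0r_neq0 // mul1r.
rewrite -natrM [leRHS](_ : _ = eps * s ^+ 2); last by field; rewrite lt0r_neq0.
by apply: le_trans est _; rewrite ler_wpM2r ?exprn_ge0.
Unshelve. all: by end_near. Qed.
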